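(* Consider the procurement (reverse) auction with participants $L$, cleared by the optimization problem described in the context, under the VCG choice function $f(B)=x^\star(B)$ and the VCG payment rule $q_j(B)=h(B^{-j})-\big(J^\star(B)-c_j^\top x_j^\star(B)\big)$ for all $j\in L$. Then: (a) The auction is a dominant-strategy incentive-compatible mechanism: for each participant $j\in L$, with $\bar B_j=(\bar c_j,p_j)$ the truthful bid of $j$, $$u_j(\bar B_j,B^{-j})\ \ge\ u_j(\tilde B_j,B^{-j})\qquad\text{for all bids }\tilde B_j\text{ and all }B^{-j}.$$ (b) The VCG outcomes are efficient, that is, the sum of all the utilities, $\sum_{j=0}^N u_j(B)$ (the operator's utility $u_0$ included), is maximized. (c) The Clarke pivot rule $h(B^{-j})=J^\star(B^{-j})$ ensures positive transfers (payments go from the operator to the participants: $q_j(B)\ge 0$ for all $j\in L$ and all $B$) and individual rationality (participants do not face negative utilities by participating in the auction: $u_j(B)\ge 0$ for all $j\in L$ and all $B$).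
   Context: $L=\{1,\dots,N\}$ is the set of auction participants (sellers). Participant $j$ places bids $B_j=(c_j,p_j)$, where $p_j\in\mathbb{R}^{n_j}$ is the vector of power supplies offered, $c_j\in\mathbb{R}^{n_j}$ the vector of corresponding requested costs, and $n_j$ the number of bids from $j$. $B=\{B_j,\ j\in L\}$ is the set of all bids, $n=\sum_{j\in L}n_j$, and $c=(c_j)_{j\in L}$, $p=(p_j)_{j\in L}$. $\bar c_j\in\mathbb{R}^{n_j}$ is participant $j$'s true cost of providing the offered power $p_j$. $B^{-j}$ denotes the bids of all participants other than $j$. For $x\in\{0,1\}^n$, $x_j\in\{0,1\}^{n_j}$ is the block indicating the accepted bids of $j$. The system operator (TSO, player $0$) has objective $J(x,y;B)=c^\top x+D(x,y)$, where $x\in\{0,1\}^n$ selects the accepted bids, $y\in\mathbb{R}^r$ collects any additional variables and $D:\{0,1\}^n\times\mathbb{R}^r\to\mathbb{R}$ is a general function. The market is cleared by $$J^\star(B)=\min_{x,y}\ J(x,y;B)\ \ \text{s.t.}\ \ g(x,y,p)\le 0,\qquad x^\star(B)=\operatorname*{argmin}_x\Big\{\min_{y:\,g(x,y,p)\le 0}J(x,y;B)\Big\},$$ where $g$ is a general constraint function which does not involve the requested costs $c$; $y^\star(B)$ denotes the corresponding optimal $y$. $J^\star(B^{-j})$ is the minimal procurement cost given all bids excluding $j$'s. A mechanism consists of a choice function $f(B)\in\{0,1\}^n$ and a payment $q_j(B)$ from the TSO to each participant $j$. The utility of participant $j\in L$ is $u_j(B)=q_j(B)-\bar c_j^\top f_j(B)$,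 where $f_j(B)$ is the block of $f(B)$ belonging to $j$. The utility of the TSO is $u_0(B)=-\big(\sum_{j=1}^N q_j(B)+D(x^\star(B),y^\star(B))\big)$. In the VCG payment rule, $h$ is a function of $B^{-j}$ only.
   Formalization: In (a) the deviating bid changes only the requested costs, with the same offered power p_j; (b) is for truthful bids; in (c) q_j ≥ 0 assumes c_j ≥ 0 and u_j ≥ 0 assumes c_j ≥ c̄_j; the minima involved are assumed attained. *)

(* Defs.v *)
From HB Require Import structures.
From mathcomp Require Import all_boot all_order all_algebra.
From mathcomp Require Import boolp classical_sets reals.

Set Implicit Arguments.
Unset Strict Implicit.
Unset Printing Implicit Defensive.

Import Order.TTheory GRing.Theory Num.Theory.

Local Open Scope classical_set_scope.
Local Open Scope ring_scope.

Definition dot (R : realType) (k : nat) (u v : 'cV[R]_k) : R := (u^T *m v) 0 0.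

(* Seller [j : 'I_N] submits [n_ j] bids.  Vectors of R^n with
   n = \sum_j n_ j are stacked with [\mxcol_j], and the block of seller [j] is
   recovered by [submxcol _ j].  Elements of {0,1}^n are boolean vectors. *)
Definition selection (N : nat) (n_ : 'I_N -> nat) := 'cV[bool]_(\sum_j n_ j).

Definition accepted (R : realType) (N : nat) (n_ : 'I_N -> nat)
    (x : selection n_) (j : 'I_N) : 'cV[R]_(n_ j) :=
  map_mx (fun b : bool => b%:R) (submxcol x j).

Record market (R : realType) (N : nat) (n_ : 'I_N -> nat) := Market {
  aux_dim : nat;
  con_dim : nat;
  D : selection n_ -> 'cV[R]_aux_dim -> R;
  (* the last argument is the vector p of offered powers; the requested costs
     are not an argument *)
  g : selection n_ -> 'cV[R]_aux_dim -> 'cV[R]_(\sum_j n_ j) -> 'cV[R]_con_dim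
}.

Record bid (R : realType) (k : nat) := Bid {
  cost : 'cV[R]_k;
  power : 'cV[R]_k
}.

Definition profile (R : realType) (N : nat) (n_ : 'I_N -> nat) :=
  forall j : 'I_N, bid R (n_ j).

Definition costs (R : realType) (N : nat) (n_ : 'I_N -> nat)
    (B : profile R n_) : 'cV[R]_(\sum_j n_ j) := \mxcol_j cost (B j).

Definition powers (R : realType) (N : nat) (n_ : 'I_N -> nat)
    (B : profile R n_) : 'cV[R]_(\sum_j n_ j) := \mxcol_j power (B j).

(* The bids B^{-j}. *)
Definition profile_wo (R : realType) (N : nat) (n_ : 'I_N -> nat) (j : 'I_N) :=
  forall i : {i : 'I_N | i != j}, bid R (n_ (val i)).

Definition others (R : realType) (N : nat) (n_ : 'I_N -> nat)
    (B : profile R n_) (j : 'I_N) : profile_wo R n_ j :=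
  fun i => B (val i).
Arguments others {R N n_} B j _.

(* The profile (b, B^{-j}); the entry [B j] is discarded. *)
Definition with_bid (R : realType) (N : nat) (n_ : 'I_N -> nat)
    (B : profile R n_) (j : 'I_N) (b : bid R (n_ j)) : profile R n_ :=
  dfwith B b.
Arguments with_bid {R N n_} B j b _.

Definition feasible (R : realType) (N : nat) (n_ : 'I_N -> nat)
    (M : market R n_) (B : profile R n_)
    (x : selection n_) (y : 'cV[R]_(aux_dim M)) : Prop :=
  forall i, g x y (powers B) i 0 <= 0.

Definition J (R : realType) (N : nat) (n_ : 'I_N -> nat)
    (M : market R n_) (B : profile R n_)
    (x : selection n_) (y : 'cV[R]_(aux_dim M)) : R :=
  dot (costs B) (map_mx (fun b : bool => b%:R) x) + D x y.

(* Objective values over the feasible points whose selection lies in [X]: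
   [X] is everything for J*(B), and the selections accepting none of the bids
   of [j] for J*(B^{-j}). *)
Definition values (R : realType) (N : nat) (n_ : 'I_N -> nat)
    (M : market R n_) (B : profile R n_) (X : set (selection n_)) : set R :=
  [set v | exists x (y : 'cV[R]_(aux_dim M)),
             [/\ X x, feasible B x y & v = J B x y]].

Definition has_min (R : realType) (S : set R) : Prop :=
  exists v, S v /\ lbound S v.

Definition rejecting (N : nat) (n_ : 'I_N -> nat) (j : 'I_N) :
    set (selection n_) :=
  [set x | submxcol x j = const_mx false].

(* [D] and [g] being arbitrary, the minimum need not be attained.  [Jstar] and
   [Jstar_wo] are used only under [solvable] and [solvable_wo], where [inf] is
   the minimum. *)
Definition solvable (R : realType) (N : nat) (n_ : 'I_N -> nat)
    (M : market R n_) (B : profile R n_) : Prop :=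
  has_min (values M B setT).

Definition Jstar (R : realType) (N : nat) (n_ : 'I_N -> nat)
    (M : market R n_) (B : profile R n_) : R :=
  inf (values M B setT).

Definition solvable_wo (R : realType) (N : nat) (n_ : 'I_N -> nat)
    (M : market R n_) (B : profile R n_) (j : 'I_N) : Prop :=
  has_min (values M B (rejecting j)).

Definition Jstar_wo (R : realType) (N : nat) (n_ : 'I_N -> nat)
    (M : market R n_) (B : profile R n_) (j : 'I_N) : R :=
  inf (values M B (rejecting j)).

Definition optimal (R : realType) (N : nat) (n_ : 'I_N -> nat)
    (M : market R n_) (B : profile R n_)
    (x : selection n_) (y : 'cV[R]_(aux_dim M)) : Prop :=
  feasible B x y /\
  forall x' (y' : 'cV[R]_(aux_dim M)), feasible B x' y' -> J B x y <= J B x' y'.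

(* A choice (x*, y* ) of optimal solutions; ties are broken arbitrarily. *)
Definition clearing (R : realType) (N : nat) (n_ : 'I_N -> nat)
    (M : market R n_) (xstar : profile R n_ -> selection n_)
    (ystar : profile R n_ -> 'cV[R]_(aux_dim M)) : Prop :=
  forall B, solvable M B -> optimal B (xstar B) (ystar B).

Definition seller_utility (R : realType) (N : nat) (n_ : 'I_N -> nat)
    (cbar : forall j : 'I_N, 'cV[R]_(n_ j))
    (x : selection n_) (q : 'I_N -> R) (j : 'I_N) : R :=
  q j - dot (cbar j) (accepted R x j).

Definition tso_utility (R : realType) (N : nat) (n_ : 'I_N -> nat)
    (M : market R n_) (x : selection n_) (y : 'cV[R]_(aux_dim M))
    (q : 'I_N -> R) : R :=
  - (\sum_j q j + D x y).

Definition total_utility (R : realType) (N : nat) (n_ : 'I_N -> nat)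
    (M : market R n_) (cbar : forall j : 'I_N, 'cV[R]_(n_ j))
    (x : selection n_) (y : 'cV[R]_(aux_dim M)) (q : 'I_N -> R) : R :=
  tso_utility x y q + \sum_j seller_utility cbar x q j.

(* [h j] is the function h applied to B^{-j}. *)
Definition vcg_payment (R : realType) (N : nat) (n_ : 'I_N -> nat)
    (M : market R n_) (xstar : profile R n_ -> selection n_)
    (h : forall j : 'I_N, profile_wo R n_ j -> R)
    (B : profile R n_) (j : 'I_N) : R :=
  h j (others B j)
  - (Jstar M B - dot (cost (B j)) (accepted R (xstar B) j)).

Definition vcg_utility (R : realType) (N : nat) (n_ : 'I_N -> nat)
    (M : market R n_) (cbar : forall j : 'I_N, 'cV[R]_(n_ j))
    (xstar : profile R n_ -> selection n_)
    (h : forall j : 'I_N, profile_wo R n_ j -> R)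
    (B : profile R n_) (j : 'I_N) : R :=
  seller_utility cbar (xstar B) (vcg_payment M xstar h B) j.

Definition vcg_total_utility (R : realType) (N : nat) (n_ : 'I_N -> nat)
    (M : market R n_) (cbar : forall j : 'I_N, 'cV[R]_(n_ j))
    (xstar : profile R n_ -> selection n_)
    (ystar : profile R n_ -> 'cV[R]_(aux_dim M))
    (h : forall j : 'I_N, profile_wo R n_ j -> R) (B : profile R n_) : R :=
  total_utility cbar (xstar B) (ystar B) (vcg_payment M xstar h B).

(* Stated at one profile and one seller: removing the bids of [j] means accepting
   none of them, and a general [g] may still read p_j, so that no function of
   B^{-j} need satisfy this equation at all [B] simultaneously. *)
Definition clarke_pivot (R : realType) (N : nat) (n_ : 'I_N -> nat)
    (M : market R n_) (h : forall j : 'I_N, profile_wo R n_ j -> R)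
    (B : profile R n_) (j : 'I_N) : Prop :=
  h j (others B j) = Jstar_wo M B j.

(* Main.v *)
(* Up to a term depending on B^{-j} alone, a truthful seller's VCG utility is
   minus the objective value attained by the clearing, and the sum of all
   utilities is minus the objective under true costs, whatever the payments.
   Both are therefore maximal at an optimal point; the Clarke pivot is the
   minimum of the same objective over a smaller set. *)

Require Import Defs.
From HB Require Import structures.
From mathcomp Require Import all_boot all_order all_algebra.
From mathcomp Require Import boolp classical_sets reals.

Import Order.TTheory GRing.Theory Num.Theory.
Local Open Scope ring_scope.

Lemma submxcol_map {A B : Type} {N : nat} {n_ : 'I_N -> nat} {m : nat}
    (f : A -> B) (x : 'M[A]_(\sum_j n_ j, m)) (j : 'I_N) :
  submxcol (map_mx f x) j = map_mx f (submxcol x j).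
Proof. by apply/matrixP => k l; rewrite !mxE. Qed.

Section Dot.
Context {R : realType}.

Lemma dotE {k} (u v : 'cV[R]_k) : dot u v = \sum_i u i 0 * v i 0.
Proof. by rewrite /dot mxE; apply: eq_bigr => i _; rewrite mxE. Qed.

Lemma dot_mxcol {N : nat} {n_ : 'I_N -> nat} (u : forall j, 'cV[R]_(n_ j))
    (v : 'cV[R]_(\sum_j n_ j)) :
  dot (\mxcol_j u j) v = \sum_j dot (u j) (submxcol v j).
Proof.
by rewrite /dot tr_mxcol -{1}[v]submxcolK mul_mxrow_mxcol summxE.
Qed.

(** The entries of [accepted] are 0 or 1. In individual rationality, [u] is the true cost and [v]
    the requested one. *)
Lemma dot_accepted_le {N : nat} {n_ : 'I_N -> nat} {x : selection n_}
    {j : 'I_N} {u v : 'cV[R]_(n_ j)} :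
  (forall k, u k 0 <= v k 0) ->
  dot u (accepted R x j) <= dot v (accepted R x j).
Proof.
move=> uv; rewrite !dotE; apply: ler_sum => k _.
by rewrite ler_wpM2r // mxE ler0n.
Qed.

End Dot.

Section Market.
Context {R : realType} {N : nat} {n_ : 'I_N -> nat} {M : market R n_}.
Implicit Types (B : profile R n_) (x : selection n_) (y : 'cV[R]_(aux_dim M)).

Lemma J_sum B x y :
  J B x y = \sum_j dot (cost (B j)) (accepted R x j) + D x y.
Proof.
rewrite /J /costs dot_mxcol; congr (_ + _).
by apply: eq_bigr => j _; rewrite submxcol_map.
Qed.

Lemma with_bid_id B j (b : bid R (n_ j)) : with_bid B j b j = b.
Proof. exact: dfwith_in. Qed.

Lemma with_bid_neq B j (b : bid R (n_ j)) i :
  i != j -> with_bid B j b i = B i.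
Proof. by rewrite eq_sym => ji; apply: dfwith_out. Qed.

Lemma others_with_bid B j (b : bid R (n_ j)) :
  others (with_bid B j b) j = others B j.
Proof. by apply: functional_extensionality_dep => -[i ij]; apply: with_bid_neq. Qed.

Lemma powers_with_bid B j (b b' : bid R (n_ j)) :
  power b = power b' -> powers (with_bid B j b) = powers (with_bid B j b').
Proof.
move=> bb'; apply: eq_mxcol => i.
have [->|ij] := eqVneq i j; first by rewrite !with_bid_id.
by rewrite !with_bid_neq.
Qed.

(** The bid of [j] enters [J] only through its own cost term, since [D] reads no bids; subtracting
    that term leaves a quantity blind to the bid. *)
Lemma J_with_bid B j (b b' : bid R (n_ j)) x y :
  J (with_bid B j b) x y - dot (cost b) (accepted R x j) =
  J (with_bid B j b') x y - dot (cost b') (accepted R x j).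
Proof.
have cancel (s t d : R) : s + t + d - s = t + d.
  by rewrite addrAC [s + t]addrC addrK.
rewrite !J_sum !(bigD1 (P := predT) j) //= !with_bid_id !cancel; congr (_ + _).
by apply: eq_bigr => i ij; rewrite !with_bid_neq.
Qed.

Lemma has_min_inf {S : set R} : has_min S -> S (inf S) /\ lbound S (inf S).
Proof.
move=> [v [Sv lbv]]; have lbS : has_lbound S by exists v.
have -> : inf S = v; last by [].
by apply/eqP; rewrite eq_le ge_inf //= lb_le_inf //; exists v.
Qed.

(** An optimal point witnesses that the minimum is attained, so [inf] takes no default value
    here. *)
Lemma Jstar_optimal {B x y} : optimal B x y -> Jstar M B = J B x y.
Proof.
move=> [fxy opt]; have Jxy : values M B setT (J B x y) by exists x, y.
have lbJ : lbound (values M B setT) (J B x y).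
  by move=> _ [x' [y' [_ fxy' ->]]]; exact: opt.
have /has_min_inf[Sinf lbinf] : has_min (values M B setT) by exists (J B x y).
by apply/eqP; rewrite eq_le lbinf // lbJ.
Qed.

(** A minimizer among the selections rejecting [j] still competes in the full problem. *)
Lemma Jstar_le_wo B j :
  solvable M B -> solvable_wo M B j -> Jstar M B <= Jstar_wo M B j.
Proof.
rewrite /Jstar_wo => /has_min_inf[_ lb] /has_min_inf[[x [y [_ fxy ->]]] _].
by apply: lb; exists x, y.
Qed.

(** The payments are transfers: what the operator pays, the sellers receive, so [q] cancels. *)
Lemma total_utilityE B (cbar : forall j, 'cV[R]_(n_ j)) x y q :
  (forall j, cost (B j) = cbar j) -> total_utility cbar x y q = - J B x y.
Proof.
move=> Bc; rewrite /total_utility /tso_utility /seller_utility sumrB J_sum.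
under [in RHS]eq_bigr do rewrite Bc.
by rewrite !opprD addrACA addNr add0r addrC.
Qed.

End Market.

Theorem theorem1 (R : realType) (N : nat) (n_ : 'I_N -> nat)
    (M : market R n_) (cbar : forall j : 'I_N, 'cV[R]_(n_ j))
    (xstar : profile R n_ -> selection n_)
    (ystar : profile R n_ -> 'cV[R]_(aux_dim M))
    (h : forall j : 'I_N, profile_wo R n_ j -> R)
    (Hclear : clearing xstar ystar) :
  (* (a) dominant-strategy incentive compatibility *)
  (forall (B : profile R n_) (j : 'I_N) (pj ctilde : 'cV[R]_(n_ j)),
      let Bbar := with_bid B j (Bid (cbar j) pj) in
      let Btilde := with_bid B j (Bid ctilde pj) in
      solvable M Bbar -> solvable M Btilde ->
      vcg_utility M cbar xstar h Bbar j >= vcg_utility M cbar xstar h Btilde j)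
  /\
  (* (b) efficiency *)
  (forall B : profile R n_,
      (forall j, cost (B j) = cbar j) -> solvable M B ->
      forall (x : selection n_) (y : 'cV[R]_(aux_dim M)) (q : 'I_N -> R),
        feasible B x y ->
        total_utility cbar x y q <= vcg_total_utility cbar xstar ystar h B)
  /\
  (* (c) Clarke pivot rule: positive transfers and individual rationality *)
  (forall (B : profile R n_) (j : 'I_N),
      solvable M B -> solvable_wo M B j -> clarke_pivot M h B j ->
      ((forall k, 0 <= cost (B j) k 0) -> 0 <= vcg_payment M xstar h B j)
      /\
      ((forall k, cbar j k 0 <= cost (B j) k 0) ->
         0 <= vcg_utility M cbar xstar h B j)).
Proof.
split; [|split].
- move=> B j pj ct Bbar Btilde solbar soltilde.
  have [optbar opttilde] := (Hclear _ solbar, Hclear _ soltilde).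
  rewrite /vcg_utility /seller_utility /vcg_payment.
  rewrite (Jstar_optimal optbar) (Jstar_optimal opttilde).
  rewrite /Bbar /Btilde !others_with_bid !with_bid_id -/Bbar -/Btilde.
  (* The deviation is re-priced at the true cost: both utilities become the same [h] term minus
     [J Bbar], taken at the two clearings. *)
  rewrite (J_with_bid B j (Bid ct pj) (Bid (cbar j) pj)) -/Bbar /=.
  rewrite -![h _ _ - _ - _]addrA -!opprD !subrK lerD2l lerN2.
  (* The deviating clearing is feasible for [Bbar]: both bids offer the power [pj], and [g] reads no
     costs. *)
  apply: optbar.2; rewrite /feasible.
  rewrite (powers_with_bid B j (Bid (cbar j) pj) (Bid ct pj)) //.
  exact: opttilde.1.
- move=> B truthful solB x y q fxy.
  rewrite /vcg_total_utility !(total_utilityE B) // lerN2.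
  exact: (Hclear _ solB).2.
- move=> B j solB solwo clarke.
  have Jle : Jstar M B <= Jstar_wo M B j by exact: Jstar_le_wo.
  (* The payment is the requested cost plus the surplus [Jstar_wo M B j - Jstar M B]. Both claims
     follow by bounding the requested cost below, by 0 or by the true cost. *)
  have payE : dot (cost (B j)) (accepted R (xstar B) j) <=
              vcg_payment M xstar h B j.
    by rewrite /vcg_payment clarke opprB addrCA lerDl subr_ge0.
  split=> [c_ge0|cbar_le].
    apply: le_trans payE.
    rewrite dotE; apply: sumr_ge0 => k _.
    by rewrite mulr_ge0 // mxE ler0n.
  rewrite /vcg_utility /seller_utility subr_ge0.
  exact: le_trans (dot_accepted_le cbar_le) payE.
Qed.
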